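(* Let $\Phi=\{\varphi_i\}_{i=1}^M$ be a unit norm frame for $\mathbb{R}^N$. Then the following hold: (a) (A necessary condition for scalability) If $\Phi$ is scalable, then $$\min_{\|d\|_2=1}\max_{i}|\langle d,\varphi_i\rangle|\ge\frac{1}{\sqrt N}.$$ (b) (A sufficient condition for scalability) If $$\min_{\|d\|_2=1}\max_{i}|\langle d,\varphi_i\rangle|\ge\sqrt{\frac{N-1}{N}},$$ then $\Phi$ is scalable. Here the minimum is over $d\in\mathbb{R}^N$ with $\|d\|_2=1$ and the maximum over $i\in\{1,\dots,M\}$.
   Context: A sequence $\Phi=\{\varphi_i\}_{i=1}^M\subset\mathbb{R}^N$ is a frame if there are $0<A\le B<\infty$ with $A\|x\|^2\le\sum_{i=1}^M|\langle x,\varphi_i\rangle|^2\le B\|x\|^2$ for all $x\in\mathbb{R}^N$; tight if one may take $A=B$; unit norm if $\|\varphi_i\|_2=1$ for all $i$. A frame $\Phi$ is scalable if there exist nonnegative scalars $s_1,\dots,s_M$ such that $\{s_i\varphi_i\}_{i=1}^M$ is a tight frame for $\mathbb{R}^N$. *)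

(* Defs.v *)
From HB Require Import structures.
From mathcomp Require Import all_boot all_order all_algebra.
From mathcomp Require Import all_classical all_reals all_analysis.
Import Order.TTheory GRing.Theory Num.Theory.
Import numFieldNormedType.Exports.

Set Implicit Arguments.
Unset Strict Implicit.
Unset Printing Implicit Defensive.

Local Open Scope classical_set_scope.
Local Open Scope ring_scope.

(* The canonical norm of 'rV[R]_N in MathComp-Analysis is the sup norm, so the
   Euclidean inner product and norm are introduced here. *)
Definition dot (R : realType) (N : nat) (u v : 'rV[R]_N) : R :=
  \sum_(j < N) u 0 j * v 0 j.

Definition norm2 (R : realType) (N : nat) (u : 'rV[R]_N) : R :=
  Num.sqrt (dot u u).

Definition frame_bounds (R : realType) (N M : nat) (A B : R)
    (phi : 'I_M -> 'rV[R]_N) : Prop :=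
  [/\ 0 < A, A <= B &
    forall x : 'rV[R]_N,
      A * norm2 x ^+ 2 <= \sum_(i < M) `|dot x (phi i)| ^+ 2 <= B * norm2 x ^+ 2].

Definition is_frame (R : realType) (N M : nat) (phi : 'I_M -> 'rV[R]_N) : Prop :=
  exists A B : R, frame_bounds A B phi.

Definition is_tight_frame (R : realType) (N M : nat)
    (phi : 'I_M -> 'rV[R]_N) : Prop :=
  exists A : R, frame_bounds A A phi.

Definition is_unit_norm (R : realType) (N M : nat)
    (phi : 'I_M -> 'rV[R]_N) : Prop :=
  forall i : 'I_M, norm2 (phi i) = 1.

Definition is_scalable (R : realType) (N M : nat)
    (phi : 'I_M -> 'rV[R]_N) : Prop :=
  exists s : 'I_M -> R,
    (forall i, 0 <= s i) /\ is_tight_frame (fun i => s i *: phi i).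

Definition unit_sphere (R : realType) (N : nat) : set 'rV[R]_N :=
  [set d | norm2 d = 1].

(* The default value 0 is harmless: the coefficients are nonnegative. *)
Definition max_coef (R : realType) (N M : nat) (phi : 'I_M -> 'rV[R]_N)
    (d : 'rV[R]_N) : R :=
  \big[Num.max/0]_(i < M) `|dot d (phi i)|.

(* Written as an infimum to have a total function; it is an attained minimum
   as soon as 0 < N, see min_max_coefP. *)
Definition min_max_coef (R : realType) (N M : nat)
    (phi : 'I_M -> 'rV[R]_N) : R :=
  inf [set max_coef phi d | d in @unit_sphere R N].

Lemma dot_self_ge0 (R : realType) (N : nat) (u : 'rV[R]_N) : 0 <= dot u u.
Proof. by apply: sumr_ge0 => j _; rewrite -expr2 sqr_ge0. Qed.

Lemma continuous_sum_ord (R : realType) (T : topologicalType) (n : nat)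
    (F : 'I_n -> T -> R) :
  (forall j, continuous (F j)) -> continuous (fun d => \sum_(j < n) F j d).
Proof. by move=> cF; apply: continuous_big => // -[x y]; exact: add_continuous. Qed.

Lemma dot_continuous (R : realType) (N : nat) (T : topologicalType)
    (f g : T -> 'rV[R]_N) :
  continuous f -> continuous g -> continuous (fun t => dot (f t) (g t)).
Proof.
move=> cf cg; apply: continuous_sum_ord => j t.
have cE (h : T -> 'rV[R]_N) : continuous h -> {for t, continuous (fun t => h t 0 j)}.
  by move=> ch; apply: continuous_comp (ch t) (@coord_continuous _ _ _ 0 j _).
exact: cvgM (cE f cf) (cE g cg).
Qed.

Lemma max_coef_continuous (R : realType) (N M : nat)
    (phi : 'I_M -> 'rV[R]_N) : continuous (max_coef phi).
Proof.
apply: continuous_big => [|i _ d].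
  by move=> z; apply: continuous_max; [exact: cvg_fst|exact: cvg_snd].
apply: (continuous_comp (f := fun d => dot d (phi i)) (g := Num.norm)).
  apply: (@dot_continuous _ _ _ id (cst (phi i))); first by move=> x; exact: cvg_id.
  exact: cst_continuous.
exact: norm_continuous.
Qed.

Lemma unit_sphere_compact (R : realType) (N : nat) : compact (@unit_sphere R N).
Proof.
have dotc : continuous (fun d : 'rV[R]_N => dot d d).
  by apply: dot_continuous => d; exact: cvg_id.
have sphE : @unit_sphere R N = (fun d : 'rV[R]_N => dot d d) @^-1` [set 1].
  apply/seteqP; split => d; rewrite /unit_sphere /norm2 /=; last first.
    by move=> ->; rewrite sqrtr1.
  by move=> h; rewrite -(sqr_sqrtr (dot_self_ge0 d)) h expr1n.
apply: bounded_closed_compact; last first.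
  rewrite sphE; apply: closed_comp; first by move=> d _; exact: dotc.
  exact: closed_eq.
exists 1; split => // y y1 d; rewrite sphE /= => dd1.
apply/ltW; apply: le_lt_trans y1.
rewrite [`|d|]mx_normrE; apply/bigmax_leP; split => // -[i j] _ /=.
rewrite (ord1 i) -(@ler_pXn2r _ 2) ?nnegrE // expr1n real_normK ?num_real //.
rewrite -dd1 /dot (bigD1 j) //= -expr2 lerDl.
by apply: sumr_ge0 => k _; rewrite -expr2 sqr_ge0.
Qed.

Lemma min_max_coefP (R : realType) (N M : nat) (phi : 'I_M -> 'rV[R]_N) :
  (0 < N)%N ->
  (exists2 d, norm2 d = 1 & max_coef phi d = min_max_coef phi) /\
  (forall d, norm2 d = 1 -> min_max_coef phi <= max_coef phi d).
Proof.
case: N phi => // N phi _.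
have sph0 : @unit_sphere R N.+1 !=set0.
  exists (delta_mx 0 0); rewrite /unit_sphere /norm2 /dot /= big_ord_recl big1.
    by rewrite !mxE !eqxx mulr1 addr0 sqrtr1.
  by move=> j _; rewrite !mxE /= mulr0.
have [|c cS cmin] := compact_EVT_min sph0 (@unit_sphere_compact R N.+1)
  (f := max_coef phi).
  exact/continuous_subspaceT/max_coef_continuous.
move: cS; rewrite inE => cS.
have lb : lbound [set max_coef phi d | d in @unit_sphere R N.+1] (max_coef phi c).
  by move=> _ [d dS <-]; apply: cmin; rewrite inE.
have infE : min_max_coef phi = max_coef phi c.
  apply/eqP; rewrite eq_le; apply/andP; split.
    by apply: ge_inf; [exists (max_coef phi c)|exists c].
  by apply: lb_le_inf => //; exists (max_coef phi c), c.
split; first by exists c.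
by move=> d dS; rewrite infE; apply: cmin; rewrite inE.
Qed.

(* Main.v *)
Require Import Defs.
From mathcomp Require Import all_boot all_order all_algebra.
From mathcomp Require Import all_classical all_reals all_analysis.
From mathcomp Require Import ring lra.
Import Order.TTheory GRing.Theory Num.Theory.
Import numFieldNormedType.Exports.

(** A quadratic form [x *m Z *m x^T] is written [dot (x *m Z) x].

    Necessity is a trace computation. If the weights [s i ^+ 2] make the frame
    tight with constant [A], then summing the tightness identity over an
    orthonormal basis gives [\sum_i s i ^+ 2 = A * N], since the [phi i] are
    unit vectors. For a unit vector [d] the identity itself says that [A] is the
    sum of the [s i ^+ 2 * dot d (phi i) ^+ 2], so [A] is at most [A * N] times
    the largest [dot d (phi i) ^+ 2] ([scalable_lower_bound]).

    Sufficiency is by contraposition. The frame is scalable as soon as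
    [N%:R^-1%:M] is a convex combination of the rank one matrices
    [(phi i)^T *m phi i] ([scalable_of_sum_outer]), that is, as soon as 0 lies
    in the convex hull of the [W i := (phi i)^T *m phi i - N%:R^-1%:M]. Let [E] be the point of that hull of least Frobenius norm
    ([min_norm_point]). It is symmetric and traceless, and its Frobenius product
    with [W i] is at least its square norm. Since [E] is traceless, this product
    is the value of the quadratic form of [E] at [phi i], so if [E] is nonzero
    then this form is positive at every [phi i].

    Such an [E] produces a bad direction [d]: a unit vector where the form is
    least, with value [m <= 0] ([traceless_direction]). The matrix
    [Z := E - m%:M] is positive semidefinite, of trace [- m * N], and its form
    vanishes at [d]; hence its value at a unit vector [x] is at most
    [\tr Z * (1 - dot d x ^+ 2)] ([psd_le_trace_kernel]). Positivity of [E] at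
    [x] then reads [- m < - m * N * (1 - dot d x ^+ 2)], which forces [m < 0] and
    [dot d x ^+ 2 < (N - 1) / N]. Applied to all the [phi i], this contradicts
    the assumed lower bound. *)

Set Implicit Arguments.
Unset Strict Implicit.
Unset Printing Implicit Defensive.

Local Open Scope classical_set_scope.
Local Open Scope ring_scope.

(** * Inner products *)

Lemma norm2_sq (R : realType) (N : nat) (u : 'rV[R]_N) : norm2 u ^+ 2 = dot u u.
Proof. by rewrite sqr_sqrtr // dot_self_ge0. Qed.

Lemma norm2_1P (R : realType) (N : nat) (u : 'rV[R]_N) :
  norm2 u = 1 <-> dot u u = 1.
Proof.
split=> [h|h]; first by rewrite -norm2_sq h expr1n.
by rewrite /norm2 h sqrtr1.
Qed.

Lemma dotC (R : realType) (N : nat) (u v : 'rV[R]_N) : dot u v = dot v u.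
Proof. by apply: eq_bigr => j _; rewrite mulrC. Qed.

Lemma dotDl (R : realType) (N : nat) (u v w : 'rV[R]_N) :
  dot (u + v) w = dot u w + dot v w.
Proof. by rewrite -big_split; apply: eq_bigr => j _; rewrite mxE mulrDl. Qed.

Lemma dotZl (R : realType) (N : nat) (a : R) (u w : 'rV[R]_N) :
  dot (a *: u) w = a * dot u w.
Proof. by rewrite /dot mulr_sumr; apply: eq_bigr => j _; rewrite mxE mulrA. Qed.

Lemma dotDr (R : realType) (N : nat) (u v w : 'rV[R]_N) :
  dot w (u + v) = dot w u + dot w v.
Proof. by rewrite dotC dotDl !(dotC w). Qed.

Lemma dotZr (R : realType) (N : nat) (a : R) (u w : 'rV[R]_N) :
  dot w (a *: u) = a * dot w u.
Proof. by rewrite dotC dotZl dotC. Qed.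

Lemma dot_suml (R : realType) (I : finType) (n : nat) (F : I -> 'rV[R]_n)
    (u : 'rV[R]_n) : dot (\sum_i F i) u = \sum_i dot (F i) u.
Proof.
rewrite /dot exchange_big; apply: eq_bigr => j _.
by rewrite summxE mulr_suml.
Qed.

Lemma dot_delta (R : realType) (N : nat) (u : 'rV[R]_N) (k : 'I_N) :
  dot u (delta_mx 0 k) = u 0 k.
Proof.
rewrite /dot (bigD1 k) //= big1 ?addr0 => [|j jk]; rewrite mxE eqxx /=.
  by rewrite eqxx mulr1.
by rewrite (negPf jk) mulr0.
Qed.

Lemma dot_self_eq0 (R : realType) (N : nat) (u : 'rV[R]_N) :
  dot u u = 0 -> u = 0.
Proof.
move=> /eqP; rewrite psumr_eq0 => [|j _]; last by rewrite -expr2 sqr_ge0.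
move=> /allP h; apply/rowP => j; rewrite mxE; apply/eqP.
by have := h j (mem_index_enum _); rewrite /= -expr2 sqrf_eq0.
Qed.

Lemma sym_dot (R : realType) (N : nat) (Z : 'M[R]_N) (x y : 'rV[R]_N) :
  Z^T = Z -> dot (x *m Z) y = dot (y *m Z) x.
Proof.
have dotE (a b : 'rV[R]_N) : dot a b = (a *m b^T) 0 0.
  by rewrite mxE; apply: eq_bigr => j _; rewrite mxE.
move=> ZT; rewrite !dotE -[in RHS]mulmxA -{2}ZT -trmx_mul.
by rewrite -[in LHS](trmxK (x *m Z)) -trmx_mul mxE.
Qed.

(** * Positive semidefinite forms and their trace *)

(** The form is nonnegative on the plane spanned by [x] and [y], so its binary
    restriction has nonpositive discriminant. *)
Lemma psd_Cauchy_Schwarz (R : realType) (N : nat) (Z : 'M[R]_N)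
    (x y : 'rV[R]_N) : Z^T = Z -> (forall x, 0 <= dot (x *m Z) x) ->
  dot (x *m Z) y ^+ 2 <= dot (x *m Z) x * dot (y *m Z) y.
Proof.
move=> ZT Zpsd.
have expand a b : 0 <= a ^+ 2 * dot (x *m Z) x + 2 * a * b * dot (x *m Z) y
    + b ^+ 2 * dot (y *m Z) y.
  have := Zpsd (a *: x + b *: y).
  rewrite mulmxDl -!scalemxAl !(dotDl, dotDr, dotZl, dotZr) (sym_dot y x) //.
  by congr (_ <= _); ring.
move: expand (Zpsd x) (Zpsd y).
move: (dot (x *m Z) x) (dot (x *m Z) y) (dot (y *m Z) y) => A B C expand.
rewrite !le_eqVlt => /predU1P[A0|A0].
  move=> /predU1P[C0|C0]; first by have := expand 1 (- B); nra.
  by have := expand C (- B); nra.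
by have := expand B (- A); nra.
Qed.

Lemma dot_Cauchy_Schwarz (R : realType) (N : nat) (x y : 'rV[R]_N) :
  dot x y ^+ 2 <= dot x x * dot y y.
Proof.
have := @psd_Cauchy_Schwarz R N 1%:M x y (trmx1 _ _); rewrite !mulmx1; apply=> z.
by rewrite mulmx1 dot_self_ge0.
Qed.

Lemma psd_trace_ge0 (R : realType) (N : nat) (Z : 'M[R]_N) :
  (forall x, 0 <= dot (x *m Z) x) -> 0 <= \tr Z.
Proof.
move=> Zpsd; apply: sumr_ge0 => k _.
by have := Zpsd (delta_mx 0 k); rewrite dot_delta -rowE mxE.
Qed.

(** Avoids eigenvalues: Cauchy-Schwarz for the form against each basis vector,
    summed, bounds the square norm of [x *m Z] by the form at [x] times the
    trace; Cauchy-Schwarz for [dot] then bounds the square of the form at [x],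
    and one factor cancels. *)
Lemma psd_le_trace (R : realType) (N : nat) (Z : 'M[R]_N) (x : 'rV[R]_N) :
  Z^T = Z -> (forall x, 0 <= dot (x *m Z) x) ->
  dot (x *m Z) x <= \tr Z * dot x x.
Proof.
move=> ZT Zpsd.
have row_bound : dot (x *m Z) (x *m Z) <= dot (x *m Z) x * \tr Z.
  rewrite /mxtrace mulr_sumr; apply: ler_sum => k _.
  have := @psd_Cauchy_Schwarz R N Z x (delta_mx 0 k) ZT Zpsd.
  by rewrite !dot_delta -rowE [row k Z _ _]mxE -expr2.
have := dot_Cauchy_Schwarz (x *m Z) x.
have := Zpsd x; have := psd_trace_ge0 Zpsd; have := dot_self_ge0 x.
move: row_bound; move: (dot (x *m Z) (x *m Z)) (dot x x) (\tr Z) => c n t.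
move: (dot (x *m Z) x) => q ct n0 t0.
rewrite le_eqVlt => /predU1P[<- _|q0 qcn]; first exact: mulr_ge0.
rewrite -(ler_pM2l q0) mulrA; apply: le_trans (ler_wpM2r n0 ct).
by rewrite -expr2.
Qed.

(** By Cauchy-Schwarz [d] is in the kernel of [Z], so the component of [x] along
    [d] does not contribute to the form: this is [psd_le_trace] for the
    projection of [x] orthogonally to [d]. *)
Lemma psd_le_trace_kernel (R : realType) (N : nat) (Z : 'M[R]_N)
    (d x : 'rV[R]_N) :
  Z^T = Z -> (forall x, 0 <= dot (x *m Z) x) ->
  dot d d = 1 -> dot (d *m Z) d = 0 ->
  dot (x *m Z) x <= \tr Z * (dot x x - dot x d ^+ 2).
Proof.
move=> ZT Zpsd d1 dZ0.
have dZ y : dot (d *m Z) y = 0.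
  apply/eqP; rewrite -sqrf_eq0 eq_le sqr_ge0 andbT.
  by have := @psd_Cauchy_Schwarz R N Z d y ZT Zpsd; rewrite dZ0 mul0r.
have := @psd_le_trace R N Z (x + (- dot x d) *: d) ZT Zpsd.
rewrite mulmxDl -!scalemxAl !(dotDl, dotDr, dotZl, dotZr) !dZ.
rewrite (sym_dot x d) // dZ d1 (dotC d x).
by rewrite !(mulr0, addr0, mulr1, mul1r); congr (_ <= _ * _); ring.
Qed.

(** * Extremal points by compactness *)

Lemma continuous_lincomb (R : realType) (T : topologicalType) (n M : nat)
    (c : 'I_M -> T -> R) (v : 'I_M -> 'rV[R]_n) :
  (forall i, continuous (c i)) -> continuous (fun t => \sum_i c i t *: v i).
Proof.
move=> cc; apply: continuous_big => [|i _ t].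
  by move=> [x y]; exact: add_continuous.
by apply: cvgZr_tmp; exact: cc.
Qed.

(** Take for [d] a minimiser of the quadratic form of [E] on the sphere: since
    the trace is zero, the form can outweigh its negative value at [d] by a
    factor of at most [N - 1] in the orthogonal directions, so a unit vector
    where it is positive cannot be too close to the line of [d]. *)
Lemma traceless_direction (R : realType) (N : nat) (E : 'M[R]_N) :
  (0 < N)%N -> E^T = E -> \tr E = 0 ->
  exists2 d : 'rV[R]_N, norm2 d = 1 &
    forall x, norm2 x = 1 -> 0 < dot (x *m E) x ->
      dot d x ^+ 2 < (N%:R - 1) / N%:R.
Proof.
move=> N0 ET trE.
have sph0 : @unit_sphere R N !=set0.
  exists (delta_mx 0 (Ordinal N0)); apply/norm2_1P.
  by rewrite dot_delta mxE !eqxx.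
have [|d] := compact_EVT_min sph0 (@unit_sphere_compact R N)
  (f := fun x : 'rV[R]_N => dot (x *m E) x).
  apply: continuous_subspaceT; apply: dot_continuous => [|x]; last exact: cvg_id.
  under eq_fun do rewrite mulmx_sum_row.
  by apply: continuous_lincomb => k; exact: coord_continuous.
rewrite inE => /norm2_1P d1 dmin; exists d; first exact/norm2_1P.
set m := dot (d *m E) d in dmin *.
pose Z : 'M[R]_N := E - m%:M.
have ZE x y : dot (x *m Z) y = dot (x *m E) y - m * dot x y.
  by rewrite /Z mulmxBr mul_mx_scalar -scaleN1r dotDl !dotZl mulN1r.
have ZT : Z^T = Z by rewrite /Z linearB /= tr_scalar_mx ET.
have trZ : \tr Z = - (m * N%:R).
  by rewrite /Z linearB /= trE mxtrace_scalar sub0r mulr_natr.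
have Zpsd x : 0 <= dot (x *m Z) x.
  have [-> |x0] := eqVneq x 0; first by rewrite mul0mx; exact: dot_self_ge0.
  have nx0 : dot x x != 0 by apply: contra_neq x0 => /dot_self_eq0.
  have nx_gt0 : 0 < dot x x by rewrite lt_neqAle eq_sym nx0 dot_self_ge0.
  have xS : (norm2 x)^-1 *: x \in @unit_sphere R N.
    rewrite inE; apply/norm2_1P; rewrite dotZl dotZr mulrA -expr2 exprVn.
    by rewrite norm2_sq mulVf.
  have := dmin _ xS; rewrite -scalemxAl dotZl dotZr mulrA -expr2 exprVn norm2_sq.
  by rewrite ZE subr_ge0 ler_pdivlMl // mulrC.
have N_gt0 : 0 < N%:R :> R by rewrite ltr0n.
have m_le0 : m <= 0.
  by have := psd_trace_ge0 Zpsd; rewrite trZ oppr_ge0 pmulr_lle0.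
move=> x /norm2_1P x1 Ex_gt0.
have dZ0 : dot (d *m Z) d = 0 by rewrite ZE d1 mulr1 subrr.
have := psd_le_trace_kernel x ZT Zpsd d1 dZ0.
rewrite ZE x1 trZ mulr1 (dotC x d) ltr_pdivlMr //.
move: (dot d x ^+ 2) (dot (x *m E) x) (N%:R : R) (m) m_le0 N_gt0 Ex_gt0 => t e n l.
by rewrite le_eqVlt => /predU1P[->|l0]; nra.
Qed.

(** The convex hull is parametrised by the unit sphere of the space of
    coefficients, with weights [s 0 i ^+ 2], so that compactness of the sphere
    provides the point [u] of least norm. The inequality is the first-order
    optimality condition along the segment from [u] to [v i]. *)
Lemma min_norm_point (R : realType) (n M : nat) (v : 'I_M -> 'rV[R]_n) :
  (0 < M)%N -> exists p : 'I_M -> R,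
    [/\ forall i, 0 <= p i, \sum_i p i = 1 &
      let u := \sum_i p i *: v i in forall i, dot u u <= dot u (v i)].
Proof.
move=> M0.
have sph0 : @unit_sphere R M !=set0.
  exists (delta_mx 0 (Ordinal M0)); apply/norm2_1P.
  by rewrite dot_delta mxE !eqxx.
pose comb (s : 'rV[R]_M) := \sum_i s 0 i ^+ 2 *: v i.
have combc : continuous comb.
  apply: continuous_lincomb => i s.
  by apply: (continuous_comp (f := fun s : 'rV[R]_M => s 0 i)
    (g := fun x => x ^+ 2)); [exact: coord_continuous|exact: exprn_continuous].
have [|s] := compact_EVT_min sph0 (@unit_sphere_compact R M)
  (f := fun s => dot (comb s) (comb s)).
  by apply: continuous_subspaceT; exact: dot_continuous.
rewrite inE => /norm2_1P s1 smin.
pose p i := s 0 i ^+ 2.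
have p_ge0 i : 0 <= p i by exact: sqr_ge0.
have sum_p : \sum_i p i = 1 by rewrite -s1; apply: eq_bigr => i _; rewrite -expr2.
have pmin q : (forall i, 0 <= q i) -> \sum_i q i = 1 ->
    dot (comb s) (comb s) <= dot (\sum_i q i *: v i) (\sum_i q i *: v i).
  move=> q0 q1; have := smin (\row_i Num.sqrt (q i)).
  have -> : comb (\row_i Num.sqrt (q i)) = \sum_i q i *: v i.
    by apply: eq_bigr => i _; rewrite mxE sqr_sqrtr.
  apply; rewrite inE; apply/norm2_1P; rewrite -q1.
  by apply: eq_bigr => i _; rewrite mxE -expr2 sqr_sqrtr.
exists p; split=> // u i; rewrite -/(comb s) in u *.
have segment (e : R) : 0 <= e -> e <= 1 ->
    dot u u <= dot ((1 - e) *: u + e *: v i) ((1 - e) *: u + e *: v i).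
  move=> e0 e1; have := pmin (fun j => (1 - e) * p j + e * (j == i)%:R).
  have -> : \sum_j ((1 - e) * p j + e * (j == i)%:R) *: v j
      = (1 - e) *: u + e *: v i.
    under eq_bigr do rewrite scalerDl -(scalerA (1 - e)) -(scalerA e).
    rewrite big_split /= -!scaler_sumr; congr (_ + e *: _).
    rewrite (bigD1 i) //= eqxx scale1r big1 ?addr0 // => j /negPf ->.
    exact: scale0r.
  apply=> [j|]; first by rewrite addr_ge0 // mulr_ge0 // subr_ge0.
  rewrite big_split /= -!mulr_sumr sum_p (bigD1 i) //= eqxx big1.
    by rewrite addr0 !mulr1 subrK.
  by move=> j /negPf ->.
rewrite leNgt; apply/negP => gap.
have seg e : 0 <= e -> e <= 1 -> dot u u <= (1 - e) ^+ 2 * dot u u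
    + 2 * e * (1 - e) * dot u (v i) + e ^+ 2 * dot (v i) (v i).
  move=> e0 e1; have := segment e e0 e1.
  rewrite !(dotDl, dotDr, dotZl, dotZr) (dotC (v i) u).
  by congr (_ <= _); ring.
move: seg gap (dot_self_ge0 u) (dot_self_ge0 (v i)).
move: (dot u u) (dot u (v i)) (dot (v i) (v i)) => a b c seg ab a0 c0.
(* A step [e] along the segment changes the square norm by
   [e * (e * (a - 2 * b + c) - 2 * (a - b))]; with this [D], the step
   [(a - b) / D] lies in [0, 1] and is short enough for the first-order term to
   dominate, even when [a - 2 * b + c] is zero. *)
pose D := 2 * a - 2 * b + c.
have D_gt0 : 0 < D by rewrite /D; lra.
have e1 : (a - b) / D <= 1 by rewrite ler_pdivrMr // /D; lra.
have e_gt0 : 0 < (a - b) / D by rewrite divr_gt0 // subr_gt0.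
have := seg _ (ltW e_gt0) e1.
have : (a - b) / D * D = a - b by rewrite mulfVK ?gt_eqF.
move: (_ / _) e1 e_gt0 => e e1 e_gt0; rewrite /D => eD le_a.
have : e * (2 * D) <= e * (a - 2 * b + c) by rewrite /D; nra.
by rewrite ler_pM2l // /D; lra.
Qed.

(** * Rank one matrices and the Frobenius product *)

Lemma dot_mxvec (R : realType) (m n : nat) (A B : 'M[R]_(m, n)) :
  dot (mxvec A) (mxvec B) = \sum_i \sum_j A i j * B i j.
Proof.
rewrite pair_bigA /= /dot (reindex _ (curry_mxvec_bij m n)) /=.
by apply: eq_bigr => -[i j] _; rewrite /= !mxvecE.
Qed.

(** Turns the Frobenius product, where convexity is used, into the value of a
    quadratic form. *)
Lemma dot_mxvec_outer (R : realType) (N : nat) (A : 'M[R]_N) (x : 'rV[R]_N) :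
  dot (mxvec A) (mxvec (x^T *m x)) = dot (x *m A) x.
Proof.
rewrite dot_mxvec exchange_big; apply: eq_bigr => j _.
rewrite mxE mulr_suml; apply: eq_bigr => i _.
by rewrite mxE big_ord1 mxE; ring.
Qed.

Lemma dot_mxvec_1 (R : realType) (N : nat) (A : 'M[R]_N) :
  dot (mxvec A) (mxvec 1%:M) = \tr A.
Proof.
rewrite dot_mxvec; apply: eq_bigr => i _; rewrite (bigD1 i) //= big1 ?addr0.
  by rewrite mxE eqxx mulr1.
by move=> j /negPf ji; rewrite mxE eq_sym ji mulr0.
Qed.

Lemma tr_outer (R : realType) (N : nat) (x : 'rV[R]_N) : \tr (x^T *m x) = dot x x.
Proof.
rewrite mxtrace_mulC /mxtrace big_ord1 mxE.
by apply: eq_bigr => j _; rewrite mxE.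
Qed.

Lemma mul_outer (R : realType) (N : nat) (x y : 'rV[R]_N) :
  x *m (y^T *m y) = dot x y *: y.
Proof.
rewrite mulmxA [x *m y^T]mx11_scalar mul_scalar_mx mxE; congr (_ *: _).
by apply: eq_bigr => j _; rewrite mxE.
Qed.

(** * Scalable frames *)

Lemma frame_nonempty (R : realType) (N M : nat) (phi : 'I_M -> 'rV[R]_N) :
  (0 < N)%N -> is_frame phi -> (0 < M)%N.
Proof.
case: M phi => // phi N0 [A [B [A0 _ /(_ (delta_mx 0 (Ordinal N0)))]]].
by rewrite big_ord0 norm2_sq dot_delta mxE !eqxx mulr1 leNgt A0.
Qed.

Lemma scalable_of_sum_outer (R : realType) (N M : nat) (phi : 'I_M -> 'rV[R]_N)
    (p : 'I_M -> R) (a : R) :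
  0 < a -> (forall i, 0 <= p i) ->
  \sum_i p i *: ((phi i)^T *m phi i) = a%:M -> is_scalable phi.
Proof.
move=> a0 p0 pE; exists (fun i => Num.sqrt (p i)).
split=> [i|]; first exact: sqrtr_ge0.
exists a; split=> // x.
have -> : \sum_i `|dot x (Num.sqrt (p i) *: phi i)| ^+ 2 = a * norm2 x ^+ 2.
  transitivity (dot (x *m a%:M) x); last by rewrite mul_mx_scalar dotZl -norm2_sq.
  rewrite -pE mulmx_sumr dot_suml; apply: eq_bigr => i _.
  rewrite -scalemxAr mul_outer !(dotZl, dotZr) normrM exprMn (dotC (phi i)).
  by rewrite !real_normK ?num_real // sqr_sqrtr // -expr2.
by rewrite lexx.
Qed.

Lemma scalable_lower_bound (R : realType) (N M : nat) (phi : 'I_M -> 'rV[R]_N)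
    (d : 'rV[R]_N) : is_unit_norm phi -> is_scalable phi -> norm2 d = 1 ->
  1 / Num.sqrt (N%:R : R) <= max_coef phi d.
Proof.
move=> phi1 [s [s_ge0 [A [A_gt0 _ tight]]]] d1.
have tightE x : \sum_i s i ^+ 2 * dot x (phi i) ^+ 2 = A * dot x x.
  have /andP[le1 le2] := tight x; apply/eqP; rewrite -norm2_sq eq_le.
  move: le1 le2; under eq_bigr do
    rewrite dotZr normrM exprMn !real_normK ?num_real //.
  by move=> -> ->.
have trace : \sum_i s i ^+ 2 = A * N%:R.
  transitivity (\sum_(k < N) \sum_i s i ^+ 2 * dot (delta_mx 0 k) (phi i) ^+ 2).
    rewrite exchange_big; apply: eq_bigr => i _; rewrite -mulr_sumr.
    under eq_bigr do rewrite dotC dot_delta expr2.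
    by rewrite -/(dot (phi i) (phi i)) ((norm2_1P _).1 (phi1 i)) mulr1.
  under eq_bigr do rewrite tightE dot_delta mxE !eqxx mulr1.
  by rewrite sumr_const card_ord mulr_natr.
set c := max_coef phi d.
have c_ge0 : 0 <= c by exact: bigmax_ge_id.
have : A <= c ^+ 2 * (A * N%:R).
  rewrite -trace -[leLHS]mulr1 -((norm2_1P _).1 d1) -tightE mulr_sumr.
  apply: ler_sum => i _; rewrite mulrC ler_wpM2r ?sqr_ge0 //.
  rewrite -[leLHS]real_normK ?num_real // ler_pXn2r ?nnegrE //.
  exact: (le_bigmax_cond _ (fun i => `|dot d (phi i)|)).
rewrite mulrCA ler_pMr // => cN.
have N_gt0 : 0 < N%:R :> R.
  rewrite lt_neqAle ler0n andbT eq_sym; apply: contraTneq cN => ->.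
  by rewrite mulr0 ler10.
rewrite ler_pdivrMr ?sqrtr_gt0 // -(@ler_pXn2r _ 2) ?nnegrE ?mulr_ge0 ?sqrtr_ge0 //.
by rewrite exprMn sqr_sqrtr ?ler0n // expr1n.
Qed.

Theorem theorem4p1 (R : realType) (N M : nat) (phi : 'I_M -> 'rV[R]_N)
    (N_gt0 : (0 < N)%N) (phi_frame : is_frame phi) (phi_unit : is_unit_norm phi) :
  (is_scalable phi -> 1 / Num.sqrt (N%:R : R) <= min_max_coef phi) /\
  (Num.sqrt ((N%:R - 1) / N%:R : R) <= min_max_coef phi -> is_scalable phi).
Proof.
have [[c c1 cE] min_le] := min_max_coefP phi N_gt0; split=> [scal|large].
  by rewrite -cE; exact: scalable_lower_bound.
have M_gt0 := frame_nonempty N_gt0 phi_frame.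
have Nr_gt0 : 0 < N%:R :> R by rewrite ltr0n.
have phi1 i : dot (phi i) (phi i) = 1 by exact/norm2_1P.
pose W i : 'M[R]_N := (phi i)^T *m phi i - N%:R^-1%:M.
have [p [p_ge0 sum_p]] := min_norm_point (fun i => mxvec (W i)) M_gt0.
pose E := \sum_i p i *: W i.
have EE : E = \sum_i p i *: ((phi i)^T *m phi i) - N%:R^-1%:M.
  rewrite /E; under eq_bigr do rewrite scalerBr.
  by rewrite sumrB -scaler_suml sum_p scale1r.
have trE : \tr E = 0.
  rewrite EE linearB /= mxtrace_scalar linear_sum /=.
  under eq_bigr do rewrite linearZ /= tr_outer phi1 mulr1.
  by rewrite sum_p -[_ *+ _]mulr_natr mulVf ?subrr // gt_eqF.
have ET : E^T = E.
  rewrite EE linearB /= tr_scalar_mx linear_sum; congr (_ - _).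
  by apply: eq_bigr => i _; rewrite linearZ /= trmx_mul trmxK.
have -> : \sum_i p i *: mxvec (W i) = mxvec E.
  by rewrite linear_sum; apply: eq_bigr => i _; rewrite linearZ.
move=> /= Emin.
have [E0|/eqP E_neq0] := eqVneq E 0.
  apply: (@scalable_of_sum_outer _ _ _ _ p N%:R^-1) => //.
    by rewrite invr_gt0.
  by apply/eqP; rewrite -subr_eq0 -EE E0.
have [d d1 d_lt] := traceless_direction N_gt0 ET trE.
have Epos i : 0 < dot (phi i *m E) (phi i).
  have -> : dot (phi i *m E) (phi i) = dot (mxvec E) (mxvec (W i)).
    rewrite -dot_mxvec_outer /W linearB /= dotDr -scaleN1r dotZr.
    have -> : N%:R^-1%:M = N%:R^-1 *: 1%:M :> 'M[R]_N by rewrite scalemx1.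
    by rewrite linearZ /= dotZr dot_mxvec_1 trE !mulr0 addr0.
  apply: lt_le_trans (Emin i); rewrite lt_neqAle dot_self_ge0 andbT eq_sym.
  apply/eqP => /dot_self_eq0 /(canRL mxvecK); rewrite linear0.
  exact: E_neq0.
have coef_lt i : `|dot d (phi i)| < Num.sqrt ((N%:R - 1) / N%:R : R).
  rewrite -sqrtr_sqr ltr_sqrt ?d_lt //.
  exact: le_lt_trans (sqr_ge0 _) (d_lt _ (phi_unit i) (Epos i)).
suff : max_coef phi d < Num.sqrt ((N%:R - 1) / N%:R : R).
  by rewrite ltNge (le_trans large (min_le _ d1)).
(* The default value 0 of the maximum also has to be below the bound. *)
apply: bigmax_lt => //.
exact: le_lt_trans (coef_lt (Ordinal M_gt0)).
Qed.
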